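(* (Complexity of MLMC with levels based on the number of time steps.) Let $\phi_\infty\in\mathbb{R}$ and let $\gamma_{\mathrm p}\ge1$, $s_{\mathrm t}>0$. Let $\beta_{\mathrm t}\ge2$ be an integer and $N_\ell=\beta_{\mathrm t}^{\ell}$. Suppose that, with constants independent of $N$, $P$ and $\ell$, the particle approximations $\phi_P^N$ and coarse couplings $\varphi_P^{N_{\ell-1}}$ (described in the context) satisfy $$|\mathrm{E}[\phi_P^N]-\phi_\infty|\lesssim N^{-1}+P^{-1},\qquad \mathrm{Var}[\phi_P^N]\lesssim P^{-1},\qquad \mathrm{Var}\big[\phi_P^{N_\ell}-\varphi_P^{N_{\ell-1}}\big]\lesssim P^{-1}N_\ell^{-s_{\mathrm t}},$$ and that the work of generating one sample of $\phi_P^{N_\ell}-\varphi_P^{N_{\ell-1}}$ is $\lesssim N_\ell P^{\gamma_{\mathrm p}}$. For fixed $0<\epsilon<1$ and any $0<\mathrm{TOL}<e^{-1}$, there exist $L$, a number of particles $P_L$ (the same on all levels), and numbers of samples $\{M_\ell\}_{\ell=0}^L$ such that the estimator $$\mathcal{A}_{\mathrm{MLMC}}=\sum_{\ell=0}^L\frac1{M_\ell}\sum_{m=1}^{M_\ell}\big(\phi_{P_L}^{N_\ell}-\varphi_{P_L}^{N_{\ell-1}}\big)\big(\boldsymbol\omega_{1:P_L}^{(\ell,m)}\big)$$ satisfies $\mathrm{P}[|\mathcal{A}_{\mathrm{MLMC}}-\phi_\infty|\ge\mathrm{TOL}]\le\epsilon$ and $$\mathrm{Work}[\mathcal{A}_{\mathrm{MLMC}}]\lesssim\begin{cases}\mathrm{TOL}^{-1-\gamma_{\mathrm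 p}}&\text{if } s_{\mathrm t}>1,\\ \mathrm{TOL}^{-1-\gamma_{\mathrm p}}(\log(\mathrm{TOL}^{-1}))^2&\text{if } s_{\mathrm t}=1,\\ \mathrm{TOL}^{-2-\gamma_{\mathrm p}+s_{\mathrm t}}&\text{if } s_{\mathrm t}<1.\end{cases}$$ In particular, for $\gamma_{\mathrm p}=2$ and $s_{\mathrm t}=2$ the work is $\lesssim \mathrm{TOL}^{-3}$.
   Context: $a\lesssim b$ means $a<cb$ for a constant $c$; in the conclusion $c$ is independent of $\mathrm{TOL}$ (it may depend on $\epsilon$). For positive integers $P,N$, $\phi_P^N=\frac1P\sum_{p=1}^P\psi(X_{p|P}^{N|N})$ is the average of a quantity of interest $\psi$ over $P$ exchangeable particles at final time $T$, where the particles follow a system of coupled SDEs in which particle $p$ is driven by its Wiener process $W_p$ and interacts with the others through the empirical measure of the system, approximated by a time-stepping scheme with $N$ uniform steps. $\phi_\infty=\mathrm{E}[\psi(X_\infty(T))]$ is the corresponding mean-field value ($X_\infty$ solves the limiting McKean-Vlasov SDE). $\boldsymbol\omega_{1:P}$ denotes the collection of underlying random inputs of the $P$ particles (Wiener paths, initial values, random coefficients), i.i.d. over particles, and $\boldsymbol\omega_{1:P}^{(\ell,m)}$ are samples of it, mutually independent over $(\ell,m)$; $\phi_P^N$ is a function of $\boldsymbol\omega_{1:P}$. The coarse coupling is $\varphi_P^{N_{\ell-1}}(\boldsymbol\omega_{1:P})=\phi_P^{N_{\ell-1}}(\boldsymbol\omega_{1:P})$ for $\ell\ge1$ (same random inputs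 on the coarser time grid), and $\varphi_{P}^{N_{-1}}=0$; hence $\mathrm{E}[\varphi_P^{N_{\ell-1}}]=\mathrm{E}[\phi_P^{N_{\ell-1}}]$ for $\ell\ge 1$. $\mathrm{Work}[\mathcal{A}_{\mathrm{MLMC}}]$ is the sum over $\ell$ of $M_\ell$ times the work of one sample of the level-$\ell$ difference. The numbers of samples are positive integers. *)

(* Defs.v *)
From HB Require Import structures.
From mathcomp Require Import all_boot all_order all_algebra.
From mathcomp Require Import all_classical all_reals all_analysis.

Set Implicit Arguments.
Unset Strict Implicit.
Unset Printing Implicit Defensive.

Import Order.TTheory GRing.Theory Num.Theory.
Import numFieldNormedType.Exports.

Local Open Scope classical_set_scope.
Local Open Scope ring_scope.

(* Mutual independence of a family of random elements: the product rule for
   every finite subfamily. *)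
Definition mutually_independent (R : realType) (d d' : measure_display)
    (Om : measurableType d) (E : measurableType d') (Pr : probability Om R)
    (I : eqType) (X : I -> Om -> E) : Prop :=
  forall (s : seq I) (A : I -> set E), uniq s -> (forall i, measurable (A i)) ->
    Pr [set x | forall i, i \in s -> A i (X i x)] =
    (\prod_(i <- s) Pr (X i @^-1` A i))%E.

Definition same_law (R : realType) (d d' : measure_display)
    (Om : measurableType d) (E : measurableType d') (Pr : probability Om R)
    (X Y : Om -> E) : Prop :=
  forall A : set E, measurable A -> Pr (X @^-1` A) = Pr (Y @^-1` A).

(* [om p] is the complete random input of particle p: its Wiener path, its
   initial value and its random coefficients, gathered in one element of U. *)
Definition iid (R : realType) (d d' : measure_display)
    (Om : measurableType d) (U : measurableType d') (Pr : probability Om R)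
    (om : nat -> Om -> U) : Prop :=
  [/\ forall p, measurable_fun setT (om p),
      mutually_independent Pr om &
      forall p, same_law Pr (om p) (om 0%N)].

(* omega_{1:P}; particles are numbered from 0. *)
Definition inputs (Om U : Type) (om : nat -> Om -> U) (P : nat) (x : Om) :
    P.-tuple U :=
  [tuple om p x | p < P].

(* [smp P l m] is omega_{1:P}^{(l,m)} (m numbered from 0): copies of
   omega_{1:P}, mutually independent over (l,m). *)
Definition independent_samples (R : realType) (d d' : measure_display)
    (Om : measurableType d) (U : measurableType d') (Pr : probability Om R)
    (om : nat -> Om -> U)
    (smp : forall P : nat, nat -> nat -> Om -> P.-tuple U) : Prop :=
  forall P : nat,
  [/\ forall l m, measurable_fun setT (smp P l m),
      forall l m, same_law Pr (smp P l m) (inputs om P) &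
      mutually_independent Pr (fun lm : nat * nat => smp P lm.1 lm.2)].

(* A time-stepping scheme on [0, horizon] for interacting particles in R^k.
   [step t dt mu x u] is the state at time t + dt of a particle which is in
   state x at time t and has input u (of which the scheme uses, for instance,
   the Wiener increment over [t, t + dt]); mu is the empirical measure, at
   time t, of the pairs (state, input) of all the particles.  It
   carries the empirical measure of the states and also covers schemes, such as
   Milstein's, in which the Wiener increments of the other particles occur. *)
Record scheme (R : realType) (k : nat) (U : Type) := Scheme {
  horizon : R;
  init : U -> k.-tuple R;
  step : R -> R -> (set (k.-tuple R * U) -> \bar R) -> k.-tuple R -> U ->
         k.-tuple R }.

Definition empirical (R : realType) (k : nat) (U : Type) (P : nat)
    (x : 'I_P -> k.-tuple R) (u : P.-tuple U) : set (k.-tuple R * U) -> \bar R :=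
  fun A => ((P%:R^-1 : R)%:E * \sum_(p < P) (\1_A (x p, tnth u p))%:E)%E.

(* X_{p|P}^{n|N}: the state of particle p after n of the N uniform steps.
   Since every particle is moved by the same map, which sees the others only
   through the empirical measure, particles with i.i.d. inputs are
   exchangeable. *)
Fixpoint particle (R : realType) (k : nat) (U : Type) (S : scheme R k U)
    (P N : nat) (u : P.-tuple U) (n : nat) : 'I_P -> k.-tuple R :=
  match n with
  | 0%N => fun p => init S (tnth u p)
  | n'.+1 => fun p =>
      step S (n'%:R * (horizon S / N%:R)) (horizon S / N%:R)
        (empirical (particle S N u n') u) (particle S N u n' p) (tnth u p)
  end.

Definition phi (R : realType) (k : nat) (U : Type) (S : scheme R k U)
    (psi : k.-tuple R -> R) (P N : nat) (u : P.-tuple U) : R :=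
  P%:R^-1 * \sum_(p < P) psi (particle S N u N p).

(* The coarse coupling at level l: the same inputs with beta^(l-1) steps, and 0
   at level 0. *)
Definition coarse (R : realType) (k : nat) (U : Type) (S : scheme R k U)
    (psi : k.-tuple R -> R) (beta P l : nat) (u : P.-tuple U) : R :=
  match l with
  | 0%N => 0
  | l'.+1 => phi S psi (beta ^ l')%N u
  end.

Definition level_diff (R : realType) (k : nat) (U : Type) (S : scheme R k U)
    (psi : k.-tuple R -> R) (beta P l : nat) (u : P.-tuple U) : R :=
  phi S psi (beta ^ l)%N u - coarse S psi beta l u.

Definition mlmc (R : realType) (k : nat) (Om U : Type) (S : scheme R k U)
    (psi : k.-tuple R -> R) (beta : nat)
    (smp : forall P : nat, nat -> nat -> Om -> P.-tuple U)
    (L P : nat) (M : nat -> nat) (x : Om) : R :=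
  \sum_(l < L.+1) (M l)%:R^-1 *
    \sum_(m < M l) level_diff S psi beta l (smp P l m x).

(* [w P l] is the work of one sample of the level-l difference. *)
Definition mlmc_work (R : realType) (w : nat -> nat -> R) (L P : nat)
    (M : nat -> nat) : R :=
  \sum_(l < L.+1) (M l)%:R * w P l.

Definition mlmc_rate (R : realType) (gamma s TOL : R) : R :=
  if 1 < s then TOL `^ (- 1 - gamma)
  else if s == 1 then TOL `^ (- 1 - gamma) * (ln TOL^-1) ^+ 2
  else TOL `^ (- 2 - gamma + s).

(* Main.v *)
Require Import Defs.
From HB Require Import structures.
From mathcomp Require Import all_boot all_order all_algebra.
From mathcomp Require Import ring lra.
From mathcomp Require Import all_classical all_reals all_analysis.
From mathcomp Require Import measurable_realfun.

Set Implicit Arguments.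
Unset Strict Implicit.
Unset Printing Implicit Defensive.

Import Order.TTheory GRing.Theory Num.Theory.
Import numFieldNormedType.Exports.

Local Open Scope classical_set_scope.
Local Open Scope ring_scope.

(** The error of the estimator splits into a bias and a fluctuation, and each is
    given half of the tolerance.

    The level differences telescope, so the estimator has the mean of the
    finest approximation [phi_P^{N_L}] (lemma [multilevel_moments]); its bias is
    at most [TOL / 2] as soon as [P] and [N_L = beta ^ L] are of order
    [TOL^-1].  The samples are independent, hence uncorrelated
    ([independent_covariance0], by Fubini on the joint law), so the variance of
    the estimator is the sum over the levels of [V_l / M_l].  By Chebyshev's
    inequality the estimator misses the tolerance with probability at most
    [eps] once this sum is at most [delta = eps (TOL / 2)^2] ([mlmc_error]).

    It remains to minimise the cost [sum_l M_l W_l] under the constraint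
    [sum_l V_l / M_l <= delta].  The Lagrange multiplier solution takes [M_l]
    proportional to [sqrt (V_l / W_l)]; after rounding up, the cost is
    [(sum_l sqrt (V_l W_l))^2 / delta + sum_l W_l] ([optimal_samples]).  Here
    [V_l W_l] is [P^(gamma - 1) beta^((1 - s) l)] up to a constant, so everything
    is governed by a geometric sum of ratio [beta^((1 - s) / 2)]: it is bounded
    if [s > 1], is the number of levels, that is a logarithm, if [s = 1], and is
    dominated by its last term if [s < 1] ([geometric_sum_rate]).  The rounding
    term [sum_l W_l] is of order [N_L P^gamma], that is [TOL^(-1 - gamma)], and
    never dominates.  [mlmc_parameters] combines these choices. *)

(** * Moments under equality in law and independence *)

Lemma Lfun2_of_sqr d (T : measurableType d) (R : realType)
    (mu : {measure set T -> \bar R}) (f : T -> R) :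
  measurable_fun setT f -> (\int[mu]_x ((f x) ^+ 2)%:E < +oo)%E ->
  f \in Lfun mu 2%:E.
Proof.
move=> mf f2; rewrite inE; apply/andP; split; rewrite inE//=.
rewrite /finite_norm unlock poweR_lty//.
under eq_integral => x _ do
  rewrite /= powR_mulrn ?normr_ge0// real_normK ?num_real//.
exact: f2.
Qed.

(** A finite variance makes [f] minus the constant [fine 'E[f]] square integrable,
    whatever the value of that constant, and adding a constant back stays in L2
    of a probability. *)
Lemma Lfun2_of_variance d (T : measurableType d) (R : realType)
    (Pr : probability T R) (f : T -> R) :
  measurable_fun setT f -> ('V_Pr[f] < +oo)%E -> f \in Lfun Pr 2%:E.
Proof.
move=> mf; rewrite /variance unlock => vf; set c := fine _ in vf.
have -> : f = (f \- cst c) \+ cst c by apply/funext => x /=; rewrite subrK.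
rewrite rpredD ?lee1n//= ?Lfun_cst// => _.
apply: Lfun2_of_sqr.
  by apply: measurable_funB.
rewrite unlock in vf; exact: vf.
Qed.

(** The positive and the negative part are transported separately to the common
    image measure, so that infinite expectations are covered too. *)
Lemma expectation_same_law (R : realType) (d d' : measure_display)
    (Om : measurableType d) (E : measurableType d') (Pr : probability Om R)
    (X Y : Om -> E) (f : E -> R) :
  measurable_fun setT X -> measurable_fun setT Y -> same_law Pr X Y ->
  measurable_fun setT f -> ('E_Pr[f \o X] = 'E_Pr[f \o Y])%E.
Proof.
move=> mX mY XY mf; rewrite unlock.
have mEf : measurable_fun setT (EFin \o f) by exact/measurable_EFinP.
have key (g : E -> \bar R) : measurable_fun setT g -> (forall y, 0 <= g y)%E ->
    (\int[Pr]_x (g \o X) x = \int[Pr]_x (g \o Y) x)%E.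
  move=> mg g0.
  rewrite -(ge0_integral_pushforward mX Pr measurableT)//.
  rewrite -(ge0_integral_pushforward mY Pr measurableT)//.
  by apply: eq_measure_integral => A mA _; exact: XY.
rewrite integralE [RHS]integralE.
congr (_ - _)%E.
- have := key _ (measurable_funepos mEf) (funepos_ge0 _).
  by rewrite -!funepos_comp.
- have := key _ (measurable_funeneg mEf) (funeneg_ge0 _).
  by rewrite -!funeneg_comp.
Qed.

Lemma variance_same_law (R : realType) (d d' : measure_display)
    (Om : measurableType d) (E : measurableType d') (Pr : probability Om R)
    (X Y : Om -> E) (f : E -> R) :
  measurable_fun setT X -> measurable_fun setT Y -> same_law Pr X Y ->
  measurable_fun setT f -> 'V_Pr[f \o X] = 'V_Pr[f \o Y].
Proof.
move=> mX mY XY mf; rewrite /variance unlock.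
rewrite -(expectation_same_law mX mY XY mf); set c := fine _.
apply: (@expectation_same_law _ _ _ _ _ _ X Y
  (fun u => (f u - c) * (f u - c))) => //.
by apply: measurable_funM; apply: measurable_funB.
Qed.

Lemma mutually_independent_pair (R : realType) (d d' : measure_display)
    (Om : measurableType d) (E : measurableType d') (Pr : probability Om R)
    (I : eqType) (X : I -> Om -> E) (i j : I) (A B : set E) :
  mutually_independent Pr X -> i != j -> measurable A -> measurable B ->
  Pr ((X i @^-1` A) `&` (X j @^-1` B)) = (Pr (X i @^-1` A) * Pr (X j @^-1` B))%E.
Proof.
move=> indX ij mA mB.
have := indX [:: i; j] (fun k => if k == i then A else B).
rewrite /= inE ij => /(_ isT).
have ji : (j == i) = false by rewrite eq_sym (negbTE ij).
rewrite !big_cons big_nil mule1 eqxx ji => <-; last by move=> k; case: ifP.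
congr (Pr _); apply/seteqP; split=> x /=.
  move=> [Ax Bx] k; rewrite !inE => /orP[] /eqP ->; rewrite ?eqxx ?ji//.
by move=> h; split; [have := h i | have := h j];
  rewrite ?ji !inE !eqxx ?orbT => /(_ isT).
Qed.

(** By independence the joint law of [f (X i)] and [g (X j)] agrees with the
    product of the two laws on rectangles, hence everywhere, and Fubini's theorem
    factorises the expectation of the product. *)
Lemma independent_covariance0 (R : realType) (d d' : measure_display)
    (Om : measurableType d) (E : measurableType d') (Pr : probability Om R)
    (I : eqType) (X : I -> Om -> E) (i j : I) (f g : E -> R) :
  mutually_independent Pr X -> i != j ->
  measurable_fun setT (X i) -> measurable_fun setT (X j) ->
  measurable_fun setT f -> measurable_fun setT g ->
  f \o X i \in Lfun Pr 2%:E -> g \o X j \in Lfun Pr 2%:E ->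
  covariance Pr (f \o X i) (g \o X j) = 0%E.
Proof.
move=> indX ij mXi mXj mf mg f2 g2.
have Pfin : Pr setT \is a fin_num := fin_num_measure Pr _ measurableT.
have f1 := Lfun_subset12 Pfin f2.
have g1 := Lfun_subset12 Pfin g2.
have fg1 := Lfun2_mul_Lfun1 f2 g2.
have mF : measurable_fun setT (f \o X i) by exact: measurableT_comp.
have mG : measurable_fun setT (g \o X j) by exact: measurableT_comp.
pose F : {RV Pr >-> R} := HB.pack (f \o X i) (isMeasurableFun.Build _ _ _ _ _ mF).
pose G : {RV Pr >-> R} := HB.pack (g \o X j) (isMeasurableFun.Build _ _ _ _ _ mG).
have mFG : measurable_fun setT (fun x => (F x, G x)).
  by apply/measurable_fun_pairP; split.
pose FG : {mfun Om >-> (R * R)%type} :=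
  HB.pack (fun x => (F x, G x)) (isMeasurableFun.Build _ _ _ _ _ mFG).
pose joint := distribution Pr FG.
have jointE A : measurable A ->
    (distribution Pr F \x distribution Pr G)%E A = joint A.
  apply: product_measure_unique => B C mB mC.
  rewrite /joint /distribution /pushforward /=.
  rewrite -(mutually_independent_pair indX ij (A := f @^-1` B) (B := g @^-1` C))//.
    by rewrite -[X in measurable X]setTI; exact: mf.
  by rewrite -[X in measurable X]setTI; exact: mg.
have mmul : measurable_fun setT (fun z : R * R => (z.1 * z.2)%:E).
  by apply/measurable_EFinP; apply: measurable_funM.
have imul : joint.-integrable setT (fun z : R * R => (z.1 * z.2)%:E).
  apply: integrable_pushforward => //.
  by move/Lfun1_integrable : fg1.
rewrite covarianceE//.
have -> : ('E_Pr[(f \o X i) * (g \o X j)] = 'E_Pr[f \o X i] * 'E_Pr[g \o X j])%E.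
  transitivity (\int[joint]_z (z.1 * z.2)%:E)%E.
    rewrite unlock integral_distribution//.
    by move/Lfun1_integrable : fg1.
  transitivity (\int[distribution Pr F \x distribution Pr G]_z (z.1 * z.2)%:E)%E.
    by apply: eq_measure_integral => A mA _; exact/esym/jointE.
  have iprod : (distribution Pr F \x distribution Pr G)%E.-integrable setT
      (fun z : R * R => (z.1 * z.2)%:E).
    move/integrableP : imul => [mm im]; apply/integrableP; split => //.
    apply: le_lt_trans im; rewrite le_eqVlt; apply/orP; left; apply/eqP.
    by apply: eq_measure_integral => A mA _; exact: jointE.
  have mean (H : {RV Pr >-> R}) : (H : Om -> R) \in Lfun Pr 1 ->
      (\int[distribution Pr H]_y y%:E = 'E_Pr[H])%E.
    move/Lfun1_integrable => iH.
    by rewrite integral_distribution// unlock.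
  have idist (H : {RV Pr >-> R}) : (H : Om -> R) \in Lfun Pr 1 ->
      (distribution Pr H).-integrable setT (EFin : R -> \bar R).
    by move/Lfun1_integrable => iH; exact: integrable_pushforward.
  rewrite -integral12_prod_meas1// /fubini_F /=.
  under eq_integral => x _.
    under eq_integral => y _ do rewrite EFinM.
    rewrite integralZl ?idist// mean// -(fineK (expectation_fin_num g1)).
    over.
  by rewrite integralZr ?idist// mean// fineK// expectation_fin_num.
by rewrite subee// fin_numM// expectation_fin_num.
Qed.

Lemma variance_sum (R : realType) (d : measure_display)
    (Om : measurableType d) (Pr : probability Om R) (I : eqType)
    (s : seq I) (X : I -> Om -> R) :
  uniq s -> (forall i, i \in s -> X i \in Lfun Pr 2%:E) ->
  (forall i j, i \in s -> j \in s -> i != j -> covariance Pr (X i) (X j) = 0%E) ->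
  'V_Pr[fun x => \sum_(i <- s) X i x] = (\sum_(i <- s) 'V_Pr[X i])%E.
Proof.
have sum2 (r : seq I) : (forall i, i \in r -> X i \in Lfun Pr 2%:E) ->
    (fun x => \sum_(i <- r) X i x) \in Lfun Pr 2%:E.
  elim: r => [_|i r IH r2].
    rewrite [X in X \in _](_ : _ = cst 0) ?Lfun_cst//.
    by apply/funext => x; rewrite big_nil.
  rewrite [X in X \in _](_ : _ = X i \+ (fun x => \sum_(k <- r) X k x)).
    rewrite rpredD ?lee1n//= ?r2 ?mem_head// IH// => k kr; apply: r2.
    by rewrite inE kr orbT.
  by apply/funext => x; rewrite big_cons.
have cov0 (r : seq I) i : X i \in Lfun Pr 2%:E ->
    (forall k, k \in r -> X k \in Lfun Pr 2%:E) ->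
    (forall k, k \in r -> covariance Pr (X i) (X k) = 0%E) ->
    covariance Pr (X i) (fun x => \sum_(k <- r) X k x) = 0%E.
  move=> i2; elim: r => [_ _|k r IH r2 r0].
    rewrite [X in covariance _ _ X](_ : _ = cst 0) ?covariance_cst_r//.
    by apply/funext => x; rewrite big_nil.
  rewrite [X in covariance _ _ X](_ : _ = X k \+ (fun x => \sum_(k <- r) X k x)).
    rewrite covarianceDr// ?r2 ?mem_head//; last first.
      by apply: sum2 => l lr; rewrite r2// inE lr orbT.
    rewrite r0 ?mem_head// add0e IH// => l lr; [apply: r2|apply: r0];
      by rewrite inE lr orbT.
  by apply/funext => x; rewrite big_cons.
elim: s => [_ _ _|i s IH /= /andP[iNs us] s2 s0].
  rewrite big_nil [X in variance _ X](_ : _ = cst 0) ?variance_cst//.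
  by apply/funext => x; rewrite big_nil.
have sub k : k \in s -> k \in i :: s by rewrite inE => ->; rewrite orbT.
rewrite [X in variance _ X](_ : _ = X i \+ (fun x => \sum_(k <- s) X k x)); last first.
  by apply/funext => x; rewrite big_cons.
have i2 : X i \in Lfun Pr 2%:E by rewrite s2// mem_head.
have t2 k : k \in s -> X k \in Lfun Pr 2%:E by move=> /sub; exact: s2.
rewrite varianceD// ?sum2// cov0//; last first.
  move=> k ks; apply: s0 => //; rewrite ?mem_head// ?sub//.
  by apply: contraNneq iNs => ->.
rewrite mule0 adde0 big_cons IH// => k l /sub ? /sub ?; exact: s0.
Qed.

(** * Choice of the numbers of samples, steps and particles *)

Lemma nat_just_above (R : realType) (y : R) :
  0 < y -> exists n : nat, [/\ (0 < n)%N, y <= n%:R & n%:R <= y + 1].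
Proof.
move=> y0; exists (Num.truncn y).+1.
have /andP[le_y gt_y] := truncn_itv (ltW y0).
by split=> //; [exact: ltW | rewrite -natr1 lerD2r].
Qed.

Lemma power_just_above (R : realType) (beta : nat) (y : R) :
  (2 <= beta)%N -> 1 <= y ->
  exists L, y <= (beta ^ L)%:R /\ (beta ^ L)%:R <= beta%:R * y.
Proof.
move=> b2 y1.
have exL : exists L, y <= (beta ^ L)%:R.
  have [n [_ yn _]] := nat_just_above (lt_le_trans ltr01 y1).
  by exists n; rewrite (le_trans yn)// ler_nat ltnW// ltn_expl.
case: (ex_minnP exL) => -[|L] yL minL.
  by exists 0%N; rewrite yL expn0 mulr_ege1// ler1n ltnW.
exists L.+1; split=> //; rewrite expnS natrM ler_pM2l ?ltr0n ?(ltnW b2)//.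
by rewrite ltW// ltNge; apply/negP => /minL; rewrite ltnn.
Qed.

(** Minimising [sum_l M l * w l] under [sum_l v l / M l <= delta] with a Lagrange
    multiplier gives [M l = g l / w l * (sum_j g j) / delta], where
    [g l = sqrt (v l * w l)].  Rounding [M l] up keeps the constraint and costs at
    most one further sample on each level. *)
Lemma optimal_samples (R : realType) (n : nat) (v w g : nat -> R) (delta : R) :
  0 < delta -> (forall l, 0 < w l) -> (forall l, 0 < g l) ->
  (forall l, v l * w l = g l ^+ 2) ->
  exists M : nat -> nat,
    [/\ forall l, (0 < M l)%N,
        \sum_(l < n.+1) v l / (M l)%:R <= delta
      & \sum_(l < n.+1) (M l)%:R * w l <=
          delta^-1 * (\sum_(l < n.+1) g l) ^+ 2 + \sum_(l < n.+1) w l].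
Proof.
move=> d0 w0 g0 vw; set G := \sum_(l < n.+1) g l.
have G0 : 0 < G.
  by rewrite /G big_ord_recl ltr_wpDr// sumr_ge0// => l _; exact: ltW.
have m0 l : 0 < delta^-1 * (g l / w l) * G by rewrite !mulr_gt0 ?invr_gt0.
have /choice[M MP] l := nat_just_above (m0 l).
exists M; split=> [l||]; first by have [] := MP l.
- rewrite [leRHS](_ : _ = \sum_(l < n.+1) delta * (g l / G)); last first.
    by rewrite -mulr_sumr -mulr_suml divff ?mulr1// gt_eqF.
  apply: ler_sum => l _; have [M0 mM _] := MP l.
  rewrite ler_pdivrMr ?ltr0n//.
  have -> : v l = delta * (g l / G) * (delta^-1 * (g l / w l) * G).
    apply: (mulIf (lt0r_neq0 (w0 l))); rewrite vw.
    by field; rewrite !gt_eqF.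
  by rewrite ler_pM2l// !mulr_gt0 ?invr_gt0.
- rewrite expr2 mulrA [_ * G]mulrAC mulr_sumr -big_split /=.
  apply: ler_sum => l _; have [_ _ Mm] := MP l.
  apply: (le_trans (ler_wpM2r (ltW (w0 l)) Mm)).
  rewrite le_eqVlt; apply/orP; left; apply/eqP.
  by field; rewrite !gt_eqF.
Qed.

Lemma powR_expn (R : realType) (b x : R) (n : nat) :
  0 <= b -> (b ^+ n) `^ x = (b `^ x) ^+ n.
Proof.
move=> b0.
by rewrite -(powR_mulrn n b0) -(powR_mulrn n (powR_ge0 b x)) powRAC.
Qed.

(** If [s > 1] the ratio of the sum is less than 1 and the sum is bounded.  If
    [s < 1] the sum is at most a constant times its last term, whose square is
    [(b ^+ L) `^ (1 - s)], at most a constant times [TOL `^ (s - 1)].  If [s = 1]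
    the sum is [L + 1], at most a constant times [ln TOL^-1] because
    [ln TOL^-1 > 1]. *)
Lemma geometric_sum_rate (R : realType) (gamma s b A : R) :
  2 <= b -> 1 <= A ->
  exists2 c : R, 0 < c & forall (TOL : R) (L : nat),
    0 < TOL < expR (- 1) -> b ^+ L <= A / TOL ->
    TOL `^ (- 1 - gamma) * (\sum_(l < L.+1) (b `^ ((1 - s) / 2)) ^+ l) ^+ 2
      <= c * mlmc_rate gamma s TOL.
Proof.
move=> b2 A1.
have b0 : 0 < b by lra.
have A0 : 0 < A by lra.
have lnA : 0 <= ln A by exact: ln_ge0.
have lnb : 0 < ln b by apply: ln_gt0; lra.
rewrite /mlmc_rate; set q := b `^ _.
have q0 : 0 < q by exact: powR_gt0.
case: ltrgtP => s1.
- have q1 : q < 1.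
    rewrite /q -[ltRHS](powRr0 b) /powR gt_eqF// ltr_expR ltr_pM2r//; lra.
  exists ((1 - q)^-1 ^+ 2) => [|TOL L /andP[T0 _] _].
    by rewrite exprn_gt0// invr_gt0 subr_gt0.
  rewrite mulrC ler_wpM2r ?powR_ge0//.
  rewrite lerXn2r ?nnegrE ?invr_ge0 ?subr_ge0 ?(ltW q1)//.
    by rewrite sumr_ge0// => l _; rewrite exprn_ge0 ?(ltW q0).
  rewrite -[leRHS]mul1r ler_pdivlMr ?subr_gt0// mulrC -opprB mulNr -subrX1 opprB.
  by rewrite gerBl exprn_ge0 ?(ltW q0).
- have q1 : 1 < q.
    rewrite /q -[ltLHS](powRr0 b) /powR gt_eqF// ltr_expR ltr_pM2r//; lra.
  exists ((q / (q - 1)) ^+ 2 * A `^ (1 - s)) => [|TOL L /andP[T0 _] bL].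
    by rewrite mulr_gt0 ?powR_gt0// exprn_gt0// divr_gt0// subr_gt0.
  have -> : TOL `^ (- 2 - gamma + s) = TOL `^ (- 1 - gamma) * TOL^-1 `^ (1 - s).
    rewrite -(powR_inv1 (ltW T0)) -powRrM -powRD ?(gt_eqF T0) ?implybT//.
    by congr (_ `^ _); lra.
  rewrite [leRHS]mulrCA ler_wpM2l ?powR_ge0//.
  rewrite -mulrA -powRM ?invr_ge0// ?(ltW A0) ?(ltW T0)//.
  have Sle : \sum_(l < L.+1) q ^+ l <= q / (q - 1) * q ^+ L.
    rewrite mulrAC ler_pdivlMr ?subr_gt0// mulrC -subrX1 -exprS.
    by rewrite gerBl.
  apply: (le_trans (y := (q / (q - 1) * q ^+ L) ^+ 2)).
    rewrite lerXn2r ?nnegrE//.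
      by rewrite sumr_ge0// => l _; rewrite exprn_ge0 ?(ltW q0).
    by rewrite mulr_ge0 ?exprn_ge0 ?divr_ge0 ?subr_ge0 ?(ltW q0) ?(ltW q1).
  rewrite exprMn ler_wpM2l ?sqr_ge0//.
  have -> : (q ^+ L) ^+ 2 = (b ^+ L) `^ (1 - s).
    rewrite powR_expn ?(ltW b0)// -exprM mulnC exprM; congr (_ ^+ _).
    by rewrite -powR_mulrn ?powR_ge0// -powRrM divfK.
  by rewrite ge0_ler_powR// ?nnegrE ?subr_ge0 ?exprn_ge0 ?divr_ge0// ltW.
- have q1 : q = 1 by rewrite /q -s1 subrr mul0r powRr0.
  exists (((ln A + 1) / ln b + 1) ^+ 2) => [|TOL L /andP[T0 Te] bL].
    by rewrite exprn_gt0// ltr_wpDl// divr_ge0 ?(ltW lnb)// addr_ge0.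
  rewrite [leRHS]mulrCA ler_wpM2l ?powR_ge0//.
  have lnT : 1 < ln TOL^-1.
    by rewrite lnV// ltrNr -(expRK (-1)) ltr_ln// posrE expR_gt0.
  have -> : \sum_(l < L.+1) q ^+ l = L%:R + 1.
    by under eq_bigr do rewrite q1 expr1n; rewrite sumr_const card_ord natr1.
  rewrite -exprMn lerXn2r ?nnegrE ?addr_ge0//.
    by rewrite mulr_ge0 ?addr_ge0 ?divr_ge0 ?addr_ge0//; lra.
  have Lle : L%:R * ln b <= ln A + ln TOL^-1.
    rewrite mulr_natl -lnXn// -lnM ?posrE ?invr_gt0// ler_ln ?posrE ?exprn_gt0//.
    by rewrite divr_gt0.
  rewrite mulrDl mul1r lerD// ?(ltW lnT)//.
  rewrite mulrAC ler_pdivlMr// (le_trans Lle)// mulrDl mul1r lerD2r.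
  by rewrite ler_peMr// ltW.
Qed.

(** With [a = 4 * C1 + 1], taking [P] and [beta ^ L] at least [a / TOL] brings the
    bias down to [TOL / 2], and there are such [P] and [L] with [P] at most
    [(a + 1) / TOL] and [beta ^ L] at most [beta * a / TOL].  Both terms of the
    cost are then at most a constant times [TOL `^ (- 1 - gamma)] times the
    squared geometric sum [G ^+ 2], which is at least 1 and so absorbs the cost of
    the rounding. *)
Lemma mlmc_parameters (R : realType) (C1 C2 C3 gamma s eps : R) (beta : nat) :
  0 < C1 -> 0 < C2 -> 0 < C3 -> 0 < eps -> 1 <= gamma -> (2 <= beta)%N ->
  exists c : R, forall TOL : R, 0 < TOL < expR (- 1) ->
  exists (L P : nat) (M : nat -> nat),
    [/\ (0 < P)%N /\ (forall l, (0 < M l)%N),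
        C1 * ((beta ^ L)%:R^-1 + P%:R^-1) <= TOL / 2,
        \sum_(l < L.+1) C2 * (P%:R^-1 * (beta ^ l)%:R `^ (- s)) / (M l)%:R
          <= eps * (TOL / 2) ^+ 2
      & \sum_(l < L.+1) (M l)%:R * (C3 * ((beta ^ l)%:R * P%:R `^ gamma))
          <= c * mlmc_rate gamma s TOL].
Proof.
move=> C1_0 C2_0 C3_0 eps0 gamma1 beta2.
pose b : R := beta%:R; have b2 : 2 <= b by rewrite ler_nat.
have [a aE] : exists a, a = 4 * C1 + 1 by eexists.
have [B BE] : exists B, B = a + 1 by eexists.
have b0 : 0 < b by lra.
have a1 : 1 <= a by lra.
have a0 : 0 < a by lra.
have B0 : 0 < B by lra.
have ba1 : 1 <= b * a by rewrite mulr_ege1//; lra.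
have [c c0 sum_rate] := geometric_sum_rate gamma s b2 ba1.
pose K := 4 * C2 * C3 / eps * B `^ (gamma - 1) + 2 * C3 * B `^ gamma * (b * a).
have K0 : 0 < K.
  by rewrite /K addr_gt0// !mulr_gt0 ?invr_gt0 ?powR_gt0 ?(lt_le_trans ltr01 ba1).
exists (K * c) => TOL TOLP; have [T0 Te] := andP TOLP.
have T1 : TOL < 1.
  by rewrite (lt_trans Te)// -[ltRHS]expR0 ltr_expR ltrN10.
have aT1 : 1 <= a / TOL by rewrite ler_pdivlMr// mul1r; lra.
have [L [La Lb]] := power_just_above beta2 aT1.
have [P [P0 Pa Pb]] := nat_just_above (lt_le_trans ltr01 aT1).
have {}P0 : 0 < P%:R :> R by rewrite ltr0n.
have PgE : P%:R `^ gamma = P%:R `^ (gamma - 1) * P%:R :> R.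
  by rewrite -{3}(powRr1 (ltW P0)) -powRD ?subrK// (gt_eqF P0) implybT.
have PB : P%:R <= B / TOL.
  by rewrite (le_trans Pb)// BE mulrDl lerD2l ler_pdivlMr// mul1r ltW.
pose q := b `^ ((1 - s) / 2).
have q0 : 0 < q by exact: powR_gt0.
pose v l := C2 * (P%:R^-1 * (beta ^ l)%:R `^ (- s)) : R.
pose w l := C3 * ((beta ^ l)%:R * P%:R `^ gamma) : R.
pose h := Num.sqrt (C2 * C3 * P%:R `^ (gamma - 1)).
have D0 : 0 < C2 * C3 * P%:R `^ (gamma - 1) by rewrite !mulr_gt0 ?powR_gt0.
have h0 : 0 < h by rewrite sqrtr_gt0.
have h2 : h ^+ 2 = C2 * C3 * P%:R `^ (gamma - 1) by rewrite sqr_sqrtr ?ltW.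
have w0 l : 0 < w l.
  by rewrite /w !mulr_gt0 ?powR_gt0// ltr0n expn_gt0 (ltnW beta2).
have g0 l : 0 < h * q ^+ l by rewrite mulr_gt0 ?exprn_gt0.
have vw l : v l * w l = (h * q ^+ l) ^+ 2.
  have -> : (h * q ^+ l) ^+ 2 = h ^+ 2 * (b `^ (1 - s)) ^+ l.
    rewrite exprMn; congr (_ * _); rewrite -exprM mulnC exprM; congr (_ ^+ _).
    by rewrite -(powR_mulrn 2 (powR_ge0 _ _)) -powRrM divfK.
  have bl0 : 0 < b ^+ l by exact: exprn_gt0.
  rewrite h2 /v /w natrX -/b -(powR_expn _ _ (ltW b0)) PgE.
  rewrite [(b ^+ l) `^ (1 - s)]powRD ?(gt_eqF bl0) ?implybT// powRr1 ?(ltW bl0)//.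
  by field; rewrite gt_eqF.
have d0 : 0 < eps * (TOL / 2) ^+ 2 by rewrite mulr_gt0 ?exprn_gt0 ?divr_gt0.
have [M [M0 varM workM]] := optimal_samples L d0 w0 g0 vw.
exists L, P, M; split => //.
- split=> //; by rewrite -(ltr0n R).
- have inv_le (x : R) : a / TOL <= x -> x^-1 <= TOL / a.
    move=> ax; rewrite -[leRHS]invf_div lef_pV2 ?posrE ?divr_gt0//.
    by rewrite (lt_le_trans _ ax) ?divr_gt0.
  apply: (le_trans (y := C1 * (TOL / a + TOL / a))).
    by rewrite ler_pM2l// lerD// inv_le.
  rewrite [leLHS](_ : _ = (2 * C1 * TOL) / a); last by field; rewrite gt_eqF.
  by rewrite ler_pdivrMr// aE; nra.
- apply: (le_trans workM).
  have -> : \sum_(l < L.+1) h * q ^+ l = h * \sum_(l < L.+1) q ^+ l.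
    by rewrite mulr_sumr.
  rewrite (exprMn _ h) h2; set G := \sum_(i < _) q ^+ i.
  have G1 : 1 <= G ^+ 2.
    rewrite exprn_ege1// /G big_ord_recl expr0 lerDl sumr_ge0// => l _.
    by rewrite exprn_ge0// ltW.
  have Pg : P%:R `^ (gamma - 1) <= B `^ (gamma - 1) * TOL^-1 `^ (gamma - 1).
    rewrite -powRM ?invr_ge0 ?(ltW B0) ?(ltW T0)//.
    by rewrite ge0_ler_powR ?nnegrE ?subr_ge0 ?divr_ge0 ?(ltW B0) ?(ltW T0) ?(ltW P0).
  have Pg' : P%:R `^ gamma <= B `^ gamma * TOL^-1 `^ gamma.
    rewrite -powRM ?invr_ge0 ?(ltW B0) ?(ltW T0)//.
    by rewrite ge0_ler_powR ?nnegrE ?divr_ge0 ?(ltW B0) ?(ltW T0) ?(ltW P0)//; lra.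
  have sumw : \sum_(l < L.+1) w l <= 2 * C3 * P%:R `^ gamma * b ^+ L.
    rewrite [leLHS](_ : _ = C3 * P%:R `^ gamma * \sum_(l < L.+1) b ^+ l).
      rewrite [2 * C3]mulrC -!mulrA ler_pM2l// [leRHS]mulrCA ler_pM2l ?powR_gt0//.
      rewrite -[leLHS]mulr1 -[leRHS]mul1r.
      have b1 : 0 < b - 1 by lra.
      rewrite -(ler_pM2l b1) !mulrA -subrX1 exprS.
      have := exprn_ge0 L (ltW b0); nra.
    by rewrite mulr_sumr; apply: eq_bigr => l _; rewrite /w natrX; ring.
  set D := TOL `^ (- 1 - gamma).
  have D_0 : 0 < D by exact: powR_gt0.
  have TE x : TOL^-1 `^ x = TOL `^ (- x).
    by rewrite -(powR_inv1 (ltW T0)) -powRrM mulN1r.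
  have DE1 : TOL^-1 `^ (gamma - 1) = TOL ^+ 2 * D.
    rewrite TE -(powR_mulrn 2 (ltW T0)) -powRD ?(gt_eqF T0) ?implybT//.
    by congr (_ `^ _); ring.
  have DE2 : TOL^-1 `^ gamma = TOL * D.
    rewrite TE -{2}(powRr1 (ltW T0)) -powRD ?(gt_eqF T0) ?implybT//.
    by congr (_ `^ _); ring.
  have key : D * G ^+ 2 <= c * mlmc_rate gamma s TOL.
    by apply: sum_rate => //; rewrite -mulrA -natrX; exact: Lb.
  rewrite -[leRHS]mulrA; apply: (le_trans (y := K * (D * G ^+ 2))); last first.
    by rewrite ler_pM2l.
  (* The two summands of [K] bound the optimal cost and the rounding cost. *)
  rewrite /K mulrDl; apply: lerD.
    rewrite [leRHS](_ : _ = (eps * (TOL / 2) ^+ 2)^-1 *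
      (C2 * C3 * (B `^ (gamma - 1) * (TOL ^+ 2 * D)) * G ^+ 2)); last first.
      by field; rewrite !gt_eqF.
    rewrite ler_pM2l ?invr_gt0// ler_wpM2r ?sqr_ge0// -DE1.
    by rewrite ler_pM2l ?mulr_gt0.
  apply: (le_trans sumw).
  apply: (le_trans (y := 2 * C3 * (B `^ gamma * (TOL * D)) * (b * (a / TOL)))).
    rewrite -DE2; apply: ler_pM;
      rewrite ?mulr_ge0 ?exprn_ge0 ?powR_ge0 ?(ltW b0) ?(ltW C3_0)//.
      by rewrite ler_pM2l// mulr_gt0.
    by rewrite -natrX.
  rewrite [leLHS](_ : _ = 2 * C3 * B `^ gamma * (b * a) * (D * 1)); last first.
    by field; rewrite gt_eqF.
  by rewrite ler_pM2l ?(ler_pM2l D_0)// !mulr_gt0 ?powR_gt0.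
Qed.

(** * Mean, variance and error of the multilevel estimator *)

Definition sample_indices (L : nat) (M : nat -> nat) : seq (nat * nat) :=
  [seq (l, m) | l <- index_iota 0 L.+1, m <- index_iota 0 (M l)].

Lemma sample_indices_uniq (L : nat) (M : nat -> nat) :
  uniq (sample_indices L M).
Proof.
apply: allpairs_uniq_dep; rewrite ?iota_uniq//.
  by move=> l _; exact: iota_uniq.
by move=> [l m] [l' m'] _ _ /= [-> ->].
Qed.

Lemma big_sample_indices (T : Type) (idx : T) (op : Monoid.law idx)
    (L : nat) (M : nat -> nat) (F : nat * nat -> T) :
  \big[op/idx]_(i <- sample_indices L M) F i =
  \big[op/idx]_(l < L.+1) \big[op/idx]_(m < M l) F (l : nat, m : nat).
Proof.
rewrite /sample_indices big_allpairs_dep /= -(big_mkord xpredT (fun l =>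
  \big[op/idx]_(m < M l) F (l, m : nat))).
by apply: eq_bigr => l _; rewrite big_mkord.
Qed.

Lemma Lfun_same_law (R : realType) (d d' : measure_display)
    (Om : measurableType d) (E : measurableType d') (Pr : probability Om R)
    (X Y : Om -> E) (f : E -> R) :
  measurable_fun setT X -> measurable_fun setT Y -> same_law Pr X Y ->
  measurable_fun setT f -> f \o Y \in Lfun Pr 2%:E -> f \o X \in Lfun Pr 2%:E.
Proof.
move=> mX mY XY mf fY; apply: Lfun2_of_variance; first exact: measurableT_comp.
rewrite (variance_same_law mX mY XY mf).
by rewrite -ge0_fin_numE ?variance_ge0// variance_fin_num.
Qed.

Lemma expectation_sum_in (R : realType) (d : measure_display)
    (Om : measurableType d) (Pr : probability Om R) (I : eqType)
    (s : seq I) (X : I -> Om -> R) :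
  (forall i, i \in s -> X i \in Lfun Pr 1) ->
  ('E_Pr[fun x => (\sum_(i <- s) X i x)%R] = \sum_(i <- s) 'E_Pr[X i])%E.
Proof.
move=> X1; rewrite -(big_map X predT (fun Y => 'E_Pr[Y]%E)) -expectation_sum.
  by congr expectation; apply/funext => x; rewrite big_map fct_sumE.
by move=> Y /mapP[i si ->]; exact: X1.
Qed.

(** The estimator is a sum over all pairs (level, sample) of uncorrelated terms,
    each weighted by [(M l)^-1]: averaging [M l] copies leaves the mean
    unchanged and divides the variance by [M l]. *)
Lemma multilevel_moments (R : realType) (d d' : measure_display)
    (Om : measurableType d) (E : measurableType d') (Pr : probability Om R)
    (Z : Om -> E) (smp : nat -> nat -> Om -> E) (D : nat -> E -> R)
    (L : nat) (M : nat -> nat) :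
  measurable_fun setT Z -> (forall l m, measurable_fun setT (smp l m)) ->
  (forall l m, same_law Pr (smp l m) Z) ->
  mutually_independent Pr (fun lm : nat * nat => smp lm.1 lm.2) ->
  (forall l, measurable_fun setT (D l)) ->
  (forall l, D l \o Z \in Lfun Pr 2%:E) ->
  (forall l, (0 < M l)%N) ->
  let A x := \sum_(l < L.+1) (M l)%:R^-1 * \sum_(m < M l) D l (smp l m x) in
  [/\ A \in Lfun Pr 2%:E,
      ('E_Pr[A] = \sum_(l < L.+1) 'E_Pr[D l \o Z])%E &
      ('V_Pr[A] = \sum_(l < L.+1) (M l)%:R^-1%:E * 'V_Pr[D l \o Z])%E].
Proof.
move=> mZ msmp law indep mD D2 M0 A.
pose X (i : nat * nat) := (M i.1)%:R^-1 \o* (D i.1 \o smp i.1 i.2).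
have Y2 l m : D l \o smp l m \in Lfun Pr 2%:E.
  exact: (Lfun_same_law (msmp l m) mZ (law l m) (mD l) (D2 l)).
have Pfin : Pr setT \is a fin_num := fin_num_measure Pr _ measurableT.
have Y1 l m := Lfun_subset12 Pfin (Y2 l m).
have X2 i : X i \in Lfun Pr 2%:E by rewrite Lfun_scale// ler1n.
have X1 i := Lfun_subset12 Pfin (X2 i).
have sum_cst l (r : R) (e : \bar R) : e \is a fin_num ->
    (\sum_(m < M l) r%:E * e = ((M l)%:R * r)%:E * e)%E.
  move=> /fineK <-; under eq_bigr do rewrite -EFinM.
  by rewrite sumEFin sumr_const card_ord -EFinM -mulrA mulr_natl.
have AE : A = fun x => \sum_(i <- sample_indices L M) X i x.
  apply/funext => x; rewrite (big_sample_indices _ _ _ (fun i => X i x)).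
  apply: eq_bigr => l _; rewrite mulr_sumr; apply: eq_bigr => m _.
  by rewrite /X /= mulrC.
rewrite AE; split.
- by rewrite [X in X \in _](_ : _ = \sum_(i <- sample_indices L M) X i)
    ?rpred_sum ?lee1n// => *; apply/funext => x; rewrite fct_sumE.
- rewrite expectation_sum_in// big_sample_indices; apply: eq_bigr => l _.
  rewrite (eq_bigr (fun=> (M l)%:R^-1%:E * 'E_Pr[D l \o Z])%E); last first.
    by move=> m _; rewrite expectationZl//= (expectation_same_law (msmp _ _) mZ).
  rewrite sum_cst ?mulfV ?mul1e// ?pnatr_eq0 -?lt0n//.
  by rewrite expectation_fin_num// Lfun_subset12.
- have cov0 i j : i != j -> covariance Pr (X i) (X j) = 0%E.
    move=> ij; have YY := Lfun2_mul_Lfun1 (Y2 i.1 i.2) (Y2 j.1 j.2).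
    rewrite covarianceZl ?covarianceZr//.
      by rewrite (independent_covariance0 indep ij)// !mule0.
    rewrite [X in X \in _](_ : _ = (M j.1)%:R^-1 \o*
      ((D i.1 \o smp i.1 i.2) \* (D j.1 \o smp j.1 j.2))) ?Lfun_scale//.
    by apply/funext => x /=; rewrite mulrA.
  rewrite (variance_sum (sample_indices_uniq L M) (fun i _ => X2 i)); last first.
    by move=> i j _ _; exact: cov0.
  rewrite big_sample_indices; apply: eq_bigr => l _.
  rewrite (eq_bigr (fun=> ((M l)%:R^-1 ^+ 2)%:E * 'V_Pr[D l \o Z])%E); last first.
    by move=> m _; rewrite varianceZ//= (variance_same_law (msmp _ _) mZ).
  rewrite sum_cst ?variance_fin_num//; congr (_%:E * _)%E.
  by rewrite expr2 mulrA mulfV ?mul1r// ?pnatr_eq0 -lt0n.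
Qed.

Lemma measurable_phi (R : realType) (d' : measure_display)
    (U : measurableType d') (k : nat) (S : scheme R k U) (psi : k.-tuple R -> R)
    (P N : nat) :
  (forall p : 'I_P,
     measurable_fun setT (fun u : P.-tuple U => particle S N u N p)) ->
  measurable_fun setT psi ->
  measurable_fun setT (fun u : P.-tuple U => phi S psi N u).
Proof.
move=> mpart mpsi; apply: measurable_funM => //.
apply: measurable_sum => p; exact: measurableT_comp.
Qed.

Lemma measurable_inputs (d d' : measure_display) (Om : measurableType d)
    (U : measurableType d') (om : nat -> Om -> U) (P : nat) :
  (forall p, measurable_fun setT (om p)) -> measurable_fun setT (inputs om P).
Proof.
move=> mom; apply/measurable_fun_tnthP => i.
rewrite [X in measurable_fun _ X](_ : _ = om i)//.
by apply/funext => x /=; rewrite tnth_mktuple.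
Qed.

Lemma sum_level_diff (R : realType) (k : nat) (U : Type) (S : scheme R k U)
    (psi : k.-tuple R -> R) (beta P L : nat) (u : P.-tuple U) :
  \sum_(l < L.+1) level_diff S psi beta l u = phi S psi (beta ^ L)%N u.
Proof.
elim: L => [|L IH]; first by rewrite big_ord1 /level_diff /= subr0.
by rewrite big_ord_recr IH /level_diff /= addrCA subrr addr0.
Qed.

(** A deviation of at least [TOL] from [phi_inf] forces a deviation of at least
    [TOL / 2] from the mean, which Chebyshev's inequality controls. *)
Lemma mlmc_error (R : realType) (d d' : measure_display)
    (Om : measurableType d) (Pr : probability Om R) (U : measurableType d')
    (om : nat -> Om -> U) (smp : forall P : nat, nat -> nat -> Om -> P.-tuple U)
    (k : nat) (S : scheme R k U) (psi : k.-tuple R -> R) (phi_inf : R)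
    (beta L P : nat) (M : nat -> nat) (v : nat -> R) (eps TOL : R) :
  (forall p, measurable_fun setT (om p)) -> independent_samples Pr om smp ->
  (forall (N : nat) (p : 'I_P), (0 < N)%N ->
     measurable_fun setT (fun u : P.-tuple U => particle S N u N p)) ->
  measurable_fun setT psi -> (0 < beta)%N -> (forall l, (0 < M l)%N) ->
  0 < TOL ->
  (`| 'E_Pr[fun x => phi S psi (beta ^ L)%N (inputs om P x)] - phi_inf%:E |
     <= (TOL / 2)%:E)%E ->
  (forall l, 'V_Pr[fun x => level_diff S psi beta l (inputs om P x)]
     <= (v l)%:E)%E ->
  \sum_(l < L.+1) v l / (M l)%:R <= eps * (TOL / 2) ^+ 2 ->
  (Pr [set x | (TOL <= `| mlmc S psi beta smp L P M x - phi_inf |)%R]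
     <= eps%:E)%E.
Proof.
move=> mom /(_ P)[msmp law indep] mpart mpsi beta0 M0 TOL0 bias varD sumv.
have mphi l : measurable_fun setT (fun u : P.-tuple U => phi S psi (beta ^ l)%N u).
  by apply: measurable_phi => // p; apply: mpart; rewrite expn_gt0 beta0.
have mD l : measurable_fun setT (fun u : P.-tuple U => level_diff S psi beta l u).
  apply: (measurable_funB (mphi l)).
  by case: l => [|l]; [exact: measurable_cst | exact: mphi].
have mZ := @measurable_inputs _ _ _ _ _ P mom.
have D2 l : (fun u => level_diff S psi beta l u) \o inputs om P \in Lfun Pr 2%:E.
  apply: Lfun2_of_variance; first exact: measurableT_comp.
  by rewrite (le_lt_trans (varD l))// ltry.
have [A2 EA VA] := multilevel_moments L mZ msmp law indep mD D2 M0.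
set A := (fun x => _) in A2 EA VA.
have Pfin : Pr setT \is a fin_num := fin_num_measure Pr _ measurableT.
have EphiA : ('E_Pr[A] = 'E_Pr[fun x => phi S psi (beta ^ L)%N (inputs om P x)])%E.
  rewrite EA -expectation_sum_in; last by move=> l _; exact: Lfun_subset12.
  by congr expectation; apply/funext => x; rewrite -sum_level_diff.
have VA_le : ('V_Pr[A] <= (eps * (TOL / 2) ^+ 2)%:E)%E.
  have VA_sum : ('V_Pr[A] <= (\sum_(l < L.+1) v l / (M l)%:R)%:E)%E.
    rewrite VA -sumEFin; apply: lee_sum => l _.
    by rewrite mulrC EFinM lee_wpmul2l//; exact: varD.
  by apply: (le_trans VA_sum); rewrite lee_fin.
have mA : measurable_fun setT A by move: A2; rewrite inE => /andP[/[!inE]].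
pose AX : {RV Pr >-> R} := HB.pack A (isMeasurableFun.Build _ _ _ _ _ mA).
have half0 : 0 < TOL / 2 by rewrite divr_gt0.
apply: (le_trans (y := Pr [set x | TOL / 2 <= `|A x - fine ('E_Pr[A])%E|])).
  have mset r c : measurable [set x | c <= `|A x - r|].
    have mAr : measurable_fun setT (fun x => `|A x - r|).
      by apply: measurableT_comp => //; exact: measurable_funB.
    have := mAr measurableT `[c, +oo[%classic (measurable_itv _).
    rewrite setTI; congr measurable; apply/seteqP.
    by split=> x; rewrite /= in_itv /= andbT.
  apply: le_measure; rewrite ?inE; [exact: mset | exact: mset | move=> x /=].
  move: bias; rewrite -EphiA -(fineK (expectation_fin_num (Lfun_subset12 Pfin A2))).
  rewrite -EFinB abse_EFin lee_fin /= => bias TOL_le.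
  have := ler_normD (A x - fine ('E_Pr[A])%E) (fine ('E_Pr[A])%E - phi_inf).
  rewrite addrA subrK -/(A x) in TOL_le *; move: TOL_le bias => /=; lra.
apply: (le_trans (chebyshev AX half0)).
apply: (le_trans (y := ((TOL / 2) ^- 2)%:E * (eps * (TOL / 2) ^+ 2)%:E)%E).
  by apply: lee_wpmul2l; rewrite // lee_fin invr_ge0 sqr_ge0.
by rewrite -EFinM lee_fin mulrCA mulVf ?mulr1// gt_eqF// exprn_gt0.
Qed.

(** * Complexity *)

Lemma mlmc_rate_gt0 (R : realType) (gamma s TOL : R) :
  0 < TOL < expR (- 1) -> 0 < mlmc_rate gamma s TOL.
Proof.
case/andP=> T0 Te; rewrite /mlmc_rate.
case: ifP => _; first exact: powR_gt0.
case: ifP => _; last exact: powR_gt0.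
rewrite mulr_gt0 ?powR_gt0// exprn_gt0// ln_gt0//.
by rewrite invf_gt1// (lt_trans Te)// -[ltRHS]expR0 ltr_expR ltrN10.
Qed.

Theorem mainTheorem3 (R : realType)
  (* probability space, random inputs of the particles and their samples *)
  (d : measure_display) (Om : measurableType d) (Pr : probability Om R)
  (d' : measure_display) (U : measurableType d')
  (om : nat -> Om -> U) (om_iid : iid Pr om)
  (smp : forall P : nat, nat -> nat -> Om -> P.-tuple U)
  (smp_indep : independent_samples Pr om smp)
  (* particle scheme and quantity of interest *)
  (k : nat) (S : scheme R k U) (horizon_gt0 : 0 < horizon S)
  (particle_meas : forall (P N : nat) (p : 'I_P), (0 < N)%N ->
     measurable_fun setT (fun u : P.-tuple U => particle S N u N p))
  (psi : k.-tuple R -> R) (psi_meas : measurable_fun setT psi)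
  (* parameters *)
  (phi_inf gamma s : R) (gamma_ge1 : 1 <= gamma) (s_gt0 : 0 < s)
  (beta : nat) (beta_ge2 : (2 <= beta)%N)
  (* rates; the first one also says that phi_P^N has a finite expectation *)
  (bias : exists C : R, forall P N : nat, (0 < P)%N -> (0 < N)%N ->
     (`| 'E_Pr[fun x => phi S psi N (inputs om P x)] - phi_inf%:E |
       < (C * (N%:R^-1 + P%:R^-1))%:E)%E)
  (var_phi : exists C : R, forall P N : nat, (0 < P)%N -> (0 < N)%N ->
     ('V_Pr[fun x => phi S psi N (inputs om P x)] < (C * P%:R^-1)%:E)%E)
  (var_diff : exists C : R, forall P l : nat, (0 < P)%N ->
     ('V_Pr[fun x => level_diff S psi beta l (inputs om P x)]
       < (C * (P%:R^-1 * (beta ^ l)%:R `^ (- s)))%:E)%E)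
  (work : nat -> nat -> R)
  (work_bound : exists C : R, forall P l : nat, (0 < P)%N ->
     work P l < C * ((beta ^ l)%:R * P%:R `^ gamma)) :
  forall eps : R, 0 < eps < 1 ->
  exists c : R, forall TOL : R, 0 < TOL < expR (- 1) ->
  exists (L P : nat) (M : nat -> nat),
    [/\ (0 < P)%N /\ (forall l, (l <= L)%N -> (0 < M l)%N),
        (Pr [set x | (TOL <= `| mlmc S psi beta smp L P M x - phi_inf |)%R]
          <= eps%:E)%E,
        mlmc_work work L P M < c * mlmc_rate gamma s TOL
      & gamma = 2 -> s = 2 -> mlmc_work work L P M < c * TOL ^- 3].
Proof.
move=> eps /andP[eps0 _].
have [mom _ _] := om_iid.
have [C1 bias1] := bias; have [C2 var2] := var_diff; have [C3' work3'] := work_bound.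
have C1_0 : 0 < C1.
  have := le_lt_trans (abse_ge0 _) (bias1 1%N 1%N isT isT).
  by rewrite lte_fin pmulr_lgt0// invr1.
have beta_gt0 l : 0 < (beta ^ l)%:R :> R by rewrite ltr0n expn_gt0 (ltnW beta_ge2).
have C2_0 : 0 < C2.
  have := le_lt_trans (variance_ge0 _ _) (var2 1%N 0%N isT).
  by rewrite lte_fin pmulr_lgt0// mulr_gt0 ?invr_gt0 ?powR_gt0.
(* Unlike [C1] and [C2], the constant [C3'] may be negative, as the work may. *)
pose C3 := Num.max C3' 1.
have C3_0 : 0 < C3 by rewrite lt_max ltr01 orbT.
have work3 P l : (0 < P)%N -> work P l <= C3 * ((beta ^ l)%:R * P%:R `^ gamma).
  move=> P0; apply: (le_trans (ltW (work3' P l P0))).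
  by rewrite ler_wpM2r ?mulr_ge0 ?powR_ge0// le_max lexx.
have [c params] := mlmc_parameters s C1_0 C2_0 C3_0 eps0 gamma_ge1 beta_ge2.
exists (c + 1) => TOL TOLP; have [T0 _] := andP TOLP.
have [L [P [M [[P0 M0] bias_le var_le work_le]]]] := params TOL TOLP.
have cost : mlmc_work work L P M < (c + 1) * mlmc_rate gamma s TOL.
  apply: (le_lt_trans (y := c * mlmc_rate gamma s TOL)).
    apply: le_trans work_le; apply: ler_sum => l _.
    by rewrite ler_wpM2l// work3.
  by rewrite mulrDl mul1r ltrDl mlmc_rate_gt0.
exists L, P, M; split=> //.
- pose v l := C2 * (P%:R^-1 * (beta ^ l)%:R `^ (- s)).
  apply: (@mlmc_error _ _ _ _ _ _ om smp k S psi phi_inf beta L P M v) => //.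
  + by move=> N p N0; exact: particle_meas.
  + exact: ltnW.
  + apply: (le_trans (ltW (bias1 P (beta ^ L)%N P0 _))).
      by rewrite expn_gt0 (ltnW beta_ge2).
    by rewrite lee_fin.
  + by move=> l; exact: ltW (var2 P l P0).
- move=> gamma2 s2; move: cost; rewrite /mlmc_rate gamma2 s2 ltr1n /=.
  rewrite (_ : - 1 - 2 = - 3%:R)//; last by ring.
  by rewrite powR_invn ?ltW.
Qed.
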